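(* Let $n\ge 1$ and $r\ge 0$ be integers, let $P$ be a permutation gate on $n$ qubits (a unitary on $(\mathbb{C}^2)^{\otimes n}$), and let $D$ be a unitary operator on $(\mathbb{C}^2)^{\otimes n}\otimes(\mathbb{C}^2)^{\otimes r}$ (the $n$ qubits on which $P$ acts together with $r$ other qubits) that preserves the computational basis of the first $n$ qubits. Let $\overline{P}$ be any approximate version of $P$ that differs from $P$ only by a local phase, i.e. $\overline{P}=D_pP$ for some diagonal unitary $D_p$ on $(\mathbb{C}^2)^{\otimes n}$. Then replacing $P$ by $\overline{P}$ does not alter the unitary $P^\dagger D P$, that is, $$(\overline{P}^{\dagger}\otimes I)\, D\,(\overline{P}\otimes I) = (P^\dagger\otimes I)\, D\,(P\otimes I),$$ where $I$ is the identity on $(\mathbb{C}^2)^{\otimes r}$.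
   Context: All matrices are taken with respect to the computational basis $\{|k\rangle : 0\le k\le 2^n-1\}$ of $(\mathbb{C}^2)^{\otimes n}$. A permutation gate is a unitary whose matrix has exactly one non-zero entry in each row and each column (the non-zero entries may be arbitrary complex phases); equivalently $P=\sum_{k}e^{i\phi_k}|p(k)\rangle\langle k|$ for a permutation $p$ of $\{0,\dots,2^n-1\}$ and real $\phi_k$. A diagonal unitary (diagonal gate) is a unitary whose matrix has non-zero entries only on the main diagonal. An approximate decomposition of a unitary $U$ is a unitary $\overline{U}=D'U$ where $D'$ is a diagonal unitary (it ''differs from $U$ only by a local phase''). A unitary $D$ on $(\mathbb{C}^2)^{\otimes n}\otimes(\mathbb{C}^2)^{\otimes r}$ preserves the computational basis of the first $n$ qubits if a basis state $|k\rangle$ of these qubits entering $D$ leaves as $|k\rangle$ up to a phase, while the state of the other $r$ qubits is allowed to change (possibly depending on $k$): for every $k\in\{0,\dots,2^n-1\}$ and every $|\psi\rangle\in(\mathbb{C}^2)^{\otimes r}$ there is $|\psi'\rangle\in(\mathbb{C}^2)^{\otimes r}$ with $D(|k\rangle\otimes|\psi\rangle)=|k\rangle\otimes|\psi'\rangle$ (phases being absorbed in $|\psi'\rangle$). For example, $D$ may be a diagonal gate on the first $n$ qubits composed with a controlled gate whose controls are the first $n$ qubits and whose targets are among the other $r$ qubits. *)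

(* Defs.v *)
From mathcomp Require Export all_boot all_order all_algebra.
From mathcomp Require Export reals.
From mathcomp Require Export complex mxtens.

Set Implicit Arguments.
Unset Strict Implicit.
Unset Printing Implicit Defensive.
Import GRing.Theory Num.Theory.
Local Open Scope ring_scope.
Local Open Scope sesquilinear_scope.

(* Operators on n qubits are matrices in the computational basis, acting on
   column vectors; the entry P j k is <j|P|k>, so A *m B is "B first, then A".
   The Kronecker product *t orders the product basis lexicographically:
   |k> (x) |l> has index k * 2 ^ r + l. *)
Notation qop C n := 'M[C]_(2 ^ n).

Section Gates.
Variables (C : numClosedFieldType) (n : nat).

Definition ket (k : 'I_(2 ^ n)) : 'cV[C]_(2 ^ n) := delta_mx k 0.

(* The nonzero entries are not required to be 1: unitarity makes them phases. *)
Definition permutation_gate (P : qop C n) : Prop :=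
  [/\ P \is unitarymx,
      forall j, exists! k, P j k != 0
    & forall k, exists! j, P j k != 0].

Definition diagonal_gate (D : qop C n) : Prop :=
  D \is unitarymx /\ is_diag_mx D.

Definition equal_up_to_local_phase (Ubar U : qop C n) : Prop :=
  exists2 D, diagonal_gate D & Ubar = D *m U.

Definition preserves_basis (r : nat) (D : 'M[C]_(2 ^ n * 2 ^ r)) : Prop :=
  forall (k : 'I_(2 ^ n)) (psi : 'cV[C]_(2 ^ r)),
    exists psi' : 'cV[C]_(2 ^ r), D *m (ket k *t psi) = ket k *t psi'.

End Gates.

(* Main.v *)
(* Write Pbar = Dp P.  The operator Dp (x) I scales |k> (x) |psi> by a phase
   depending only on k, and D maps such a vector to some |k> (x) |psi'>, so the
   two commute; the phases then cancel in (Dp (x) I)^* D (Dp (x) I). *)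

Require Import Defs.
Local Open Scope ring_scope.
Local Open Scope sesquilinear_scope.

Import GRing.Theory Num.Theory.

Set Implicit Arguments.
Unset Strict Implicit.

Lemma tensmxZl (R : pzRingType) m n p q (c : R) (A : 'M[R]_(m, n))
    (B : 'M[R]_(p, q)) :
  (c *: A) *t B = c *: (A *t B).
Proof. by apply/matrixP => i j; rewrite !mxE mulrA. Qed.

Lemma tens1mx (R : pzRingType) m n :
  (1%:M : 'M[R]_m) *t (1%:M : 'M[R]_n) = 1%:M.
Proof.
apply/matrixP => i j.
case: (mxtens_indexP i) => i1 i2; case: (mxtens_indexP j) => j1 j2.
(* An entry of the left side is a product of two Kronecker deltas, hence a conjunction of booleans
   cast to [R]; injectivity of [mxtens_index] makes it the delta on pairs. *)
rewrite tensmxE !mxE -natrM mulnb (can_eq (@mxtens_indexK m n)).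
by rewrite xpair_eqE.
Qed.

(** Turns a column index of an operator on the joint system into a product vector, the form of input
    that [preserves_basis] speaks about. *)
Lemma delta_mx_tens (R : pzRingType) m n (k : 'I_m) (l : 'I_n) :
  delta_mx (mxtens_index (k, l)) 0
    = (delta_mx k 0 : 'cV[R]_m) *t (delta_mx l 0 : 'cV[R]_n).
Proof.
apply/matrixP => i j; case: (mxtens_indexP i) => i1 i2.
rewrite !mxE !mxtens_indexK /= !ord1 !eqxx !andbT -natrM mulnb.
by rewrite (can_eq (@mxtens_indexK m n)) xpair_eqE.
Qed.

Lemma diag_mul_delta (R : pzRingType) n (A : 'M[R]_n) (k : 'I_n) :
  is_diag_mx A -> A *m (delta_mx k 0 : 'cV_n) = A k k *: delta_mx k 0.
Proof.
move=> /is_diag_mxP A_diag; apply/colP => i.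
rewrite -colE !mxE eqxx andbT; case: (eqVneq i k) => [-> | ne_ik].
  by rewrite mulr1.
by rewrite mulr0 A_diag // ne_ik.
Qed.

Lemma diag_tens1_comm (C : numClosedFieldType) (n r : nat) (A : qop C n)
    (D : 'M[C]_(2 ^ n * 2 ^ r)) :
  is_diag_mx A -> preserves_basis D ->
  D *m (A *t (1%:M : qop C r)) = (A *t (1%:M : qop C r)) *m D.
Proof.
move=> A_diag D_basis; apply/matrixP => i j.
(* Columns are images of basis vectors, so it suffices to compare both sides on each |k> (x) |l>. *)
suff /colP/(_ i) : col j (D *m (A *t (1%:M : qop C r)))
    = col j ((A *t (1%:M : qop C r)) *m D) by rewrite !mxE.
case: (mxtens_indexP j) => k l; rewrite !colE delta_mx_tens -!mulmxA.
have [psi Dpsi] := D_basis k (delta_mx l 0); rewrite /ket in Dpsi.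
(* An arbitrary [phi] is needed: the scaling is applied to |l> before [D] acts and to [psi] after
   it. *)
have A_scale (phi : 'cV[C]_(2 ^ r)) :
    (A *t 1%:M) *m ((delta_mx k 0 : 'cV_(2 ^ n)) *t phi)
      = A k k *: ((delta_mx k 0 : 'cV_(2 ^ n)) *t phi).
  by rewrite tensmx_mul mul1mx diag_mul_delta // tensmxZl.
by rewrite A_scale -scalemxAr Dpsi A_scale.
Qed.

Theorem theorem2 (R : realType) (n r : nat) (n_gt0 : (0 < n)%N)
    (P : qop R[i] n) (D : 'M[R[i]]_(2 ^ n * 2 ^ r)) (Pbar : qop R[i] n) :
  permutation_gate P ->
  D \is unitarymx ->
  preserves_basis D ->
  equal_up_to_local_phase Pbar P ->
  (Pbar ^t* *t (1%:M : qop R[i] r)) *m D *m (Pbar *t (1%:M : qop R[i] r))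
  = (P ^t* *t (1%:M : qop R[i] r)) *m D *m (P *t (1%:M : qop R[i] r)).
Proof.
move=> _ _ D_basis [Dp [Dp_unitary Dp_diag] ->].
(* [unitarymxP] gives a matrix times its adjoint; the opposite order comes from applying it to the
   adjoint of [Dp]. *)
have Dp_tV : Dp ^t* *m Dp = 1%:M.
  by rewrite -[X in _ *m X]trmxCK; apply/unitarymxP; rewrite trmxC_unitary.
have tens_mul1 (A B : qop R[i] n) :
    (A *m B) *t (1%:M : qop R[i] r)
      = (A *t (1%:M : qop R[i] r)) *m (B *t (1%:M : qop R[i] r)).
  by rewrite tensmx_mul mul1mx.
rewrite trmx_mul map_mxM !tens_mul1 !mulmxA.
(* Moves [Dp] (x) I leftwards across [D], next to its adjoint. *)
rewrite -[_ *m D *m (Dp *t _)]mulmxA (diag_tens1_comm Dp_diag D_basis) mulmxA.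
by rewrite -[_ *m (Dp *t _)]mulmxA -tens_mul1 Dp_tV tens1mx mulmx1.
Qed.
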